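(* Let $n\ge 1$, let $s_1,\dots,s_n>0$ be the amounts spent by the $n$ faculty members, and let $B>0$ with $B<s_1+\cdots+s_n$. Then the strategy profile $\mathbf r^*=(s_1,s_2,\dots,s_n)$, in which each faculty member $i$ requests $s_i$, is a Nash equilibrium for the travel allocation game. That is, for every $i\in\{1,\dots,n\}$ and every $r_i>0$ with $B<r_i+\sum_{j\ne i}s_j$, $$u_i(\mathbf r^*,s_i)\ \ge\ u_i\big((r_i,\mathbf r^*_{-i}),s_i\big).$$
   Context: The travel allocation game (new method) has as players the $n$ faculty members. Player $i$'s strategy is a request $r_i>0$; a strategy profile is $\mathbf r=(r_1,\dots,r_n)$, with total $R=r_1+\cdots+r_n$. The total travel budget is $B$, and only the case $B<R$ is considered. The amount $s_i$ that player $i$ will actually spend is fixed. The reimbursement to player $i$ is $$g_i(\mathbf r,s_i)=\begin{cases}(B/R)\,s_i & \text{if } s_i\le r_i,\\ (B/R)\,r_i & \text{if } s_i>r_i,\end{cases}$$ where $R$ is the sum of all entries of $\mathbf r$, and player $i$'s utility is $u_i(\mathbf r,s_i)=g_i(\mathbf r,s_i)-s_i$. For a profile $\mathbf r^*$, $(r_i,\mathbf r^*_{-i})$ denotes $\mathbf r^*$ with its $i$-th entry replaced by $r_i$. A profile $\mathbf r^*$ is a Nash equilibrium if, for all $i$, $u_i(\mathbf r^*,s_i)\ge u_i((r_i,\mathbf r^*_{-i}),s_i)$ for every (admissible) $r_i$. *)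

(* Defs.v *)
(* MathComp, with the real numbers of MathComp-Analysis (realType). *)
From mathcomp Require Import all_boot all_order all_algebra.
From mathcomp Require Import reals.

Set Implicit Arguments.
Unset Strict Implicit.
Unset Printing Implicit Defensive.

Import Order.TTheory GRing.Theory Num.Theory.
Local Open Scope ring_scope.

Definition total_request (R : realType) (n : nat) (r : 'I_n -> R) : R :=
  \sum_(i < n) r i.

(* The strategy profiles of the game: only the case where the requests exceed
   the budget B is considered. *)
Definition admissible (R : realType) (n : nat) (B : R) (r : 'I_n -> R) : Prop :=
  (forall i, 0 < r i) /\ B < total_request r.

(* [x] is the amount actually spent by player [i]. *)
Definition reimbursement (R : realType) (n : nat) (B : R) (i : 'I_n)
    (r : 'I_n -> R) (x : R) : R :=
  if x <= r i then B / total_request r * x else B / total_request r * r i.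

Definition utility (R : realType) (n : nat) (B : R) (i : 'I_n)
    (r : 'I_n -> R) (x : R) : R :=
  reimbursement B i r x - x.

Definition deviate (R : realType) (n : nat) (r : 'I_n -> R) (i : 'I_n) (ri : R) :
    'I_n -> R :=
  fun j => if j == i then ri else r j.

(* The first conjunct says that [r] is itself a profile of the game.  In the
   second, the total after the deviation is ri + \sum_(j | j != i) r j, and the
   requests of the other players are positive by the first conjunct. *)
Definition Nash_equilibrium (R : realType) (n : nat) (B : R) (s : 'I_n -> R)
    (r : 'I_n -> R) : Prop :=
  admissible B r /\
  forall (i : 'I_n) (ri : R), 0 < ri -> B < total_request (deviate r i ri) ->
    utility B i r (s i) >= utility B i (deviate r i ri) (s i).

(* Main.v *)
(* Let T be the total requested by the other players. Overstating only shrinks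
   the rate B / (r + T) applied to s_i; understating pays B r / (r + T), which
   is nondecreasing in r because T >= 0. *)
Require Import Defs.
From mathcomp Require Import all_boot all_order all_algebra.
From mathcomp Require Import reals.
Import Order.TTheory GRing.Theory Num.Theory.
Local Open Scope ring_scope.

Lemma total_request_split (R : realType) (n : nat) (r : 'I_n -> R) (i : 'I_n) :
  total_request r = r i + \sum_(j < n | j != i) r j.
Proof. by rewrite /total_request (bigD1 i). Qed.

Lemma total_request_deviate (R : realType) (n : nat) (r : 'I_n -> R) (i : 'I_n)
    (x : R) :
  total_request (deviate r i x) = x + \sum_(j < n | j != i) r j.
Proof.
rewrite (total_request_split _ _ _ i) {1}/deviate eqxx; congr (_ + _).
by apply: eq_bigr => j /negPf ji; rewrite /deviate ji.
Qed.

(** After cross-multiplying, both sides contain the product of [x] and [y]; cancelling it leaves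
    [x * T <= y * T]. *)
Lemma ler_share (R : realFieldType) (T x y : R) :
  0 <= T -> 0 < x -> x <= y -> x / (x + T) <= y / (y + T).
Proof.
move=> T0 x0 xy; have y0 := lt_le_trans x0 xy.
rewrite ler_pdivrMr ?ltr_wpDr// mulrAC ler_pdivlMr ?ltr_wpDr//.
by rewrite !mulrDr (mulrC y x) lerD2l ler_wpM2r.
Qed.

Theorem proposition3 (R : realType) (n : nat) (hn : (1 <= n)%N)
    (s : 'I_n -> R) (hs : forall i, 0 < s i)
    (B : R) (hB : 0 < B) (hBs : B < \sum_(i < n) s i) :
  Nash_equilibrium B s s.
Proof.
split=> // i x x0 _.
(* The spending [s i] cancels, so only reimbursements are compared; the truthful one falls in the
   first branch by [lexx]. *)
rewrite /utility lerD2r /reimbursement lexx total_request_deviate.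
rewrite (total_request_split _ _ s i) /deviate eqxx.
have T0 : 0 <= \sum_(j < n | j != i) s j by apply: sumr_ge0 => j _; exact: ltW.
case: (leP (s i) x) => [sx|/ltW xs].
  rewrite ler_wpM2r ?(ltW (hs i))// ler_wpM2l ?(ltW hB)//.
  by rewrite lef_pV2 ?posrE ?ltr_wpDr// lerD2r.
(* Both payments are regrouped as [B] times a share [r / (r + T)], the form [ler_share] compares. *)
by rewrite -!mulrA !(mulrC _^-1) ler_wpM2l ?(ltW hB)// ler_share.
Qed.
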